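(* Every finitely generated residually finite torsion group embeds into a torsion group that is residually $\mathcal{FS}$.
   Context: $\mathcal{FS}$ denotes the class of finite simple groups. For a class $\mathcal{C}$ of groups, a group $H$ is said to be residually $\mathcal{C}$ if the intersection of all normal subgroups $N$ of $H$ with $H/N \in \mathcal{C}$ is the trivial group. A group is residually finite if it is residually $\mathcal{C}$ for $\mathcal{C}$ the class of finite groups. A torsion group is a group in which every element has finite order. A group $G$ embeds into a group $\Gamma$ if there is an injective group homomorphism $G \to \Gamma$. *)

(* Defs.v *)
From HB Require Import structures.
From mathcomp Require Import all_boot generic_quotient.
From mathcomp Require Import boolp classical_sets cardinality.

Set Implicit Arguments.
Unset Strict Implicit.
Unset Printing Implicit Defensive.

Local Open Scope classical_set_scope.
Local Open Scope group_scope.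
Local Open Scope quotient_scope.

(* The library's [simple], [coset_of], [<<_>>] only exist for finite groups;
   here a group is an arbitrary [groupType]. *)

Definition is_subgroup (G : groupType) (H : set G) : Prop :=
  H 1 /\ forall x y, H x -> H y -> H (x / y).

Record normal_subgroup (G : groupType) := NormalSubgroup {
  normal_set :> set G;
  normal_subgroupP : is_subgroup normal_set;
  normal_conjP : forall x y, normal_set x -> normal_set (x ^ y)
}.

Section QuotientGroup.
Variables (G : groupType) (N : normal_subgroup G).
Implicit Types x y z : G.

Lemma nsub1 : normal_set N 1.
Proof. by case: (normal_subgroupP N). Qed.

Lemma nsubV x : normal_set N x -> normal_set N x^-1.
Proof.
have [N1 Nd] := normal_subgroupP N.
by move=> /(Nd _ _ N1); rewrite div1g.
Qed.

Lemma nsubM x y : normal_set N x -> normal_set N y -> normal_set N (x * y).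
Proof.
have [_ Nd] := normal_subgroupP N.
by move=> Nx /nsubV /(Nd _ _ Nx); rewrite invgK.
Qed.

Definition coset_rel : rel G := fun x y => `[< normal_set N (x^-1 * y) >].

Lemma coset_rel_refl : reflexive coset_rel.
Proof. by move=> x; apply/asboolP; rewrite mulVg; exact: nsub1. Qed.

Lemma coset_rel_sym : symmetric coset_rel.
Proof.
by move=> x y; apply/asboolP/asboolP => /nsubV; rewrite invgM invgK.
Qed.

Lemma coset_rel_trans : transitive coset_rel.
Proof.
move=> y x z /asboolP Nxy /asboolP Nyz; apply/asboolP.
by have := nsubM Nxy Nyz; rewrite mulgA mulgK.
Qed.

Canonical coset_equiv :=
  EquivRel coset_rel coset_rel_refl coset_rel_sym coset_rel_trans.

Definition quot_group := {eq_quot coset_equiv}.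

HB.instance Definition _ := Choice.on quot_group.
HB.instance Definition _ := EqQuotient.on quot_group.

Definition quot_one : quot_group := \pi_quot_group 1.
Definition quot_inv (a : quot_group) : quot_group :=
  \pi_quot_group (repr a)^-1.
Definition quot_mul (a b : quot_group) : quot_group :=
  \pi_quot_group (repr a * repr b).

Lemma quot_piP x y :
  reflect (normal_set N (x^-1 * y))
    (\pi_quot_group x == \pi_quot_group y).
Proof. by rewrite eqmodE; apply: asboolP. Qed.

Lemma quot_reprP x : normal_set N ((repr (\pi_quot_group x))^-1 * x).
Proof. by apply/quot_piP; rewrite reprK. Qed.

Lemma quot_mul_pi x y :
  quot_mul (\pi_quot_group x) (\pi_quot_group y)
    = \pi_quot_group (x * y).
Proof.
apply/eqP/quot_piP; set x' := repr _; set y' := repr _.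
have Nx : normal_set N (x'^-1 * x) := quot_reprP x.
have Ny : normal_set N (y'^-1 * y) := quot_reprP y.
have := nsubM (@normal_conjP _ N _ y' Nx) Ny.
by rewrite /conjg invgM !mulgA mulgK.
Qed.

Lemma quot_inv_pi x : quot_inv (\pi_quot_group x) = \pi_quot_group x^-1.
Proof.
apply/eqP/quot_piP; set x' := repr _.
have Nx : normal_set N (x'^-1 * x) := quot_reprP x.
have := nsubV (@normal_conjP _ N _ x'^-1 Nx).
by rewrite /conjg !invgK !mulgA mulgV mul1g invgM invgK.
Qed.

Lemma quot_mulA : associative quot_mul.
Proof.
move=> a b c; rewrite -[a]reprK -[b]reprK -[c]reprK.
rewrite (quot_mul_pi (repr b)) (quot_mul_pi (repr a)) (quot_mul_pi (repr a)).
by rewrite quot_mul_pi mulgA.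
Qed.

Lemma quot_mul1g : left_id quot_one quot_mul.
Proof. by move=> a; rewrite -[a]reprK quot_mul_pi mul1g. Qed.

Lemma quot_mulg1 : right_id quot_one quot_mul.
Proof. by move=> a; rewrite -[a]reprK quot_mul_pi mulg1. Qed.

Lemma quot_mulVg : left_inverse quot_one quot_inv quot_mul.
Proof. by move=> a; rewrite -[a]reprK quot_inv_pi quot_mul_pi mulVg. Qed.

Lemma quot_mulgV : right_inverse quot_one quot_inv quot_mul.
Proof. by move=> a; rewrite -[a]reprK quot_inv_pi quot_mul_pi mulgV. Qed.

HB.instance Definition _ := isGroup.Build quot_group
  quot_mulA quot_mul1g quot_mulg1 quot_mulVg quot_mulgV.

End QuotientGroup.

Definition generated_subgroup (G : groupType) (A : set G) : set G :=
  smallest (@is_subgroup G) A.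

Definition finitely_generated (G : groupType) : Prop :=
  exists2 A : set G, finite_set A & generated_subgroup A = [set: G].

Definition torsion_group (G : groupType) : Prop :=
  forall x : G, exists2 n : nat, 0 < n & x ^+ n = 1.

Definition finite_group (G : groupType) : Prop := finite_set [set: G].

Definition simple_group (G : groupType) : Prop :=
  [set: G] <> [set 1] /\
  forall N : normal_subgroup G, N = [set 1] :> set G \/ N = [set: G] :> set G.

(* Abelian simple groups, i.e. the groups of prime order, are included. *)
Definition finite_simple_group (G : groupType) : Prop :=
  finite_group G /\ simple_group G.

(* The intersection of the empty family is the whole group. *)
Definition residually (C : groupType -> Prop) (H : groupType) : Prop :=
  \bigcap_(N in [set N : normal_subgroup H | C (quot_group N)])
    (N : set H) = [set 1].

Definition embeds (G Gamma : groupType) : Prop :=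
  exists f : {multiplicative G -> Gamma}, injective f.

(* Main.v *)
Require Import Defs.
From mathcomp Require Import all_boot.
From HB Require Import structures.
From mathcomp Require Import all_fingroup all_solvable.
From mathcomp Require Import generic_quotient finmap.
From mathcomp Require Import boolp classical_sets cardinality.

(** Let G be residually finite and torsion. Index by i the finite quotients of
G, and embed the i-th one into a finite simple group S_i, a large alternating
group; the resulting maps phi_i : G -> S_i together separate the points of G.
The group Gamma consists of the families in the product of all the S_i that
agree with the diagonal image (phi_i g)_i of some g in G at all but finitely
many coordinates.

- Gamma contains the diagonal copy of G, and also the direct sum of the S_i;
  hence every coordinate projection Gamma -> S_i is onto, and its kernel is a
  normal subgroup with finite simple quotient. A family killed by all the
  projections is trivial, so Gamma is residually finite simple
  ([residually_finite_simple_almost_diagonal]).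
- Gamma is torsion ([torsion_almost_diagonal]): if x agrees with g up to
  finitely many coordinates and g has order k, then x ^+ k has finite support
  and finite coordinate groups, so some power of it is trivial.

That a finite group embeds into a finite simple group is Cayley's theorem
followed by a doubling of the permuted set: a permutation acting in the same
way on two copies of a set is even ([finite_group_embeds_simple]). *)

Set Implicit Arguments.
Unset Strict Implicit.
Unset Printing Implicit Defensive.

Local Open Scope classical_set_scope.
Local Open Scope group_scope.
Local Open Scope quotient_scope.

(** * Homomorphisms and kernels *)

Section Morphism.
Variables (G H : groupType) (f : {multiplicative G -> H}).

Lemma multiplicative1 : f 1 = 1.
Proof. by apply: (mulgI (f 1)); rewrite -gmulfM !mulg1. Qed.

Lemma multiplicativeV x : f x^-1 = (f x)^-1.
Proof. by apply: (mulgI (f x)); rewrite -gmulfM !mulgV multiplicative1. Qed.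

Lemma multiplicativeX n x : f (x ^+ n) = f x ^+ n.
Proof.
elim: n => [|n IHn]; first by rewrite !expg0 multiplicative1.
by rewrite !expgS gmulfM IHn.
Qed.

Lemma multiplicativeJ x y : f (x ^ y) = f x ^ f y.
Proof. by rewrite /conjg !gmulfM multiplicativeV. Qed.

Lemma kernel_is_subgroup : is_subgroup [set x | f x = 1].
Proof.
split=> [|x y /= fx fy]; first exact: multiplicative1.
by rewrite gmulfM multiplicativeV fx fy divgg.
Qed.

Lemma kernel_conj x y : f x = 1 -> f (x ^ y) = 1.
Proof. by move=> fx; rewrite multiplicativeJ fx conj1g. Qed.

Definition kernel : normal_subgroup G :=
  NormalSubgroup kernel_is_subgroup kernel_conj.

Lemma kernel_piP x y :
  (\pi_(quot_group kernel) x = \pi_(quot_group kernel) y) <-> f x = f y.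
Proof.
split=> [/eqP/quot_piP/=|fxy]; last first.
  by apply/eqP/quot_piP; rewrite /= gmulfM multiplicativeV fxy mulVg.
by rewrite gmulfM multiplicativeV => /(canRL (mulVKg _)); rewrite mulg1.
Qed.

End Morphism.

Lemma piM (G : groupType) (N : normal_subgroup G) (x y : G) :
  \pi_(quot_group N) (x * y)
    = \pi_(quot_group N) x * \pi_(quot_group N) y.
Proof. by apply/esym; have := @quot_mul_pi _ N x y. Qed.

Lemma piV (G : groupType) (N : normal_subgroup G) (x : G) :
  \pi_(quot_group N) x^-1 = (\pi_(quot_group N) x)^-1.
Proof. by apply/esym; have := @quot_inv_pi _ N x. Qed.

Lemma piJ (G : groupType) (N : normal_subgroup G) (x y : G) :
  \pi_(quot_group N) (x ^ y)
    = \pi_(quot_group N) x ^ \pi_(quot_group N) y.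
Proof. by rewrite /conjg !piM piV. Qed.

(** First isomorphism theorem: the quotient by the kernel of a surjection onto
S is S, so it inherits from S being finite and simple. *)
Lemma finite_simple_quot_kernel (G S : groupType) (f : {multiplicative G -> S}) :
  (forall s, exists x, f x = s) -> finite_simple_group S ->
  finite_simple_group (quot_group (kernel f)).
Proof.
move=> f_onto [finS [ntS simS]]; pose K := quot_group (kernel f).
split.
  have fr_inj : injective (fun a : K => f (repr a)).
    by move=> a b /kernel_piP; rewrite !reprK.
  apply: (@finite_preimage _ _ [set: S] (fun a : K => f (repr a))) => // a b _ _.
  exact: fr_inj.
split=> [/seteqP[trivK _]|M].
  apply: ntS; apply/seteqP; split=> // s _ /=; have [x <-] := f_onto s.
  rewrite -(multiplicative1 f); apply/kernel_piP; exact: (trivK (\pi_K x)).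
pose M' := f @` [set x | (M : set K) (\pi_K x)].
have M'P x : M' (f x) -> (M : set K) (\pi_K x).
  by case=> y /= My /kernel_piP <-.
have subM' : is_subgroup M'.
  split; first by exists 1; [exact: (nsub1 M) | exact: multiplicative1].
  move=> _ _ [x /= Mx <-] [y /= My <-]; exists (x * y^-1) => /=.
    by rewrite piM piV; apply: nsubM => //; apply: nsubV.
  by rewrite gmulfM multiplicativeV.
have nM' s t : M' s -> M' (s ^ t).
  move=> [x /= Mx <-]; have [y <-] := f_onto t; exists (x ^ y) => /=.
    by rewrite piJ; apply: normal_conjP.
  exact: multiplicativeJ.
have [/= M'1|/= M'T] := simS (NormalSubgroup subM' nM'); [left|right].
  apply/seteqP; split=> [a Ma|_ ->] /=; last exact: nsub1.
  have : M' (f (repr a)) by exists (repr a) => //=; rewrite reprK.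
  rewrite M'1 /= -(multiplicative1 f) => /kernel_piP; rewrite reprK => ->.
  by [].
apply/seteqP; split=> // a _; rewrite -[a]reprK; apply: M'P.
by rewrite M'T.
Qed.

(** * Finite groups embed into finite simple groups *)

Section DoublePerm.
Variable T : finType.
Implicit Types s t : {perm T}.

Let double_fun s (u : T * bool) := (s u.1, u.2).

Lemma double_fun_inj s : injective (double_fun s).
Proof. by move=> [x b] [y c] [/perm_inj-> ->]. Qed.

Definition double_perm s : {perm T * bool} := perm (@double_fun_inj s).

Lemma double_permM s t : double_perm (s * t) = double_perm s * double_perm t.
Proof. by apply/permP => u; rewrite permM !permE /double_fun /= permM. Qed.

Lemma double_perm_inj : injective double_perm.
Proof.
move=> s t st; apply/permP => x.
by have /permP/(_ (x, true)) := st; rewrite !permE => -[].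
Qed.

Let left_fun s (u : T * bool) := if u.2 then (s u.1, u.2) else u.

Let left_fun_inj s : injective (left_fun s).
Proof. by move=> [x []] [y []] // [/perm_inj->]. Qed.

Let swap_fun (u : T * bool) := (u.1, ~~ u.2).

Let swap_fun_inj : injective swap_fun.
Proof. by move=> [x b] [y c] [-> /negb_inj->]. Qed.

(** The action on the two copies of T is the product of the action on one copy
and of its conjugate by the exchange of the copies, two permutations of equal
parity. *)
Lemma odd_double_perm s : odd_perm (double_perm s) = false.
Proof.
pose l := perm (@left_fun_inj s); pose w := perm swap_fun_inj.
have -> : double_perm s = l * l ^ w.
  have wK : w^-1 = w.
    apply: (mulgI w); rewrite mulgV; apply/permP=> -[x b].
    by rewrite permM !permE /swap_fun /= negbK.
  apply/permP=> -[x []]; rewrite /conjg wK !permM !permE /double_fun.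
    by rewrite /left_fun /swap_fun.
  by rewrite /left_fun /swap_fun.
by rewrite odd_permM odd_permJ addbb.
Qed.

End DoublePerm.

(** Cayley's theorem. Q acts by right translations, because permutations are
composed from left to right, and on the finite type that enumerates it, because
Q itself need not carry a finite type structure. *)
Lemma finite_group_perm (Q : groupType) : finite_group Q ->
  exists (T : finType) (h : {multiplicative Q -> {perm T}}),
    0 < #|T| /\ injective h.
Proof.
move=> /finite_fsetP[X XE].
have inX x : x \in X by have : [set: Q] x by []; rewrite XE.
pose f x : X := FSetSub (inX x).
pose act (x : Q) (t : X) := f (val t * x).
have act_inj x : injective (act x).
  by move=> s t /(congr1 val) /= /mulIg/val_inj.
pose h x := perm (act_inj x).
have hM : {morph h : x y / x * y}.
  by move=> x y; apply/permP=> t; apply: val_inj; rewrite permM !permE /= mulgA.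
pose h' : {multiplicative Q -> {perm X}} :=
  HB.pack h (isMultiplicative.Build _ _ h hM).
exists X, h'.
split; first by apply/card_gt0P; exists (f 1).
move=> x y /permP/(_ (f 1)); rewrite !permE => /(congr1 val) /=.
by rewrite !mul1g.
Qed.

(** The torsion of Q is read off its image in a finite symmetric group. *)
Lemma finite_group_torsion (Q : groupType) : finite_group Q -> torsion_group Q.
Proof.
move=> /finite_group_perm[T [h [_ h_inj]]] x; exists #[h x]; first exact: order_gt0.
by apply: h_inj; rewrite multiplicativeX expg_order multiplicative1.
Qed.

(** A set-theoretic normal subgroup of a finite group becomes a normal finite
group once membership is made decidable by classical logic. *)
Lemma finite_simple_subg (gT : finGroupType) (A : {group gT}) :
  simple A -> finite_simple_group (subg_of A).
Proof.
move=> simA; split; first exact: finite_finset.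
have /simpleP[nt simS] : simple [subg A] by rewrite -(isog_simple (isog_subg A)).
split.
  move=> /seteqP[triv _]; case/eqP: nt; apply/setP => x; rewrite !inE.
  by apply/esym/eqP; apply: triv.
move=> N; pose B := [set x : subg_of A | `[< (N : set _) x >]]%SET.
have BP x : reflect ((N : set _) x) (x \in B) by rewrite inE; apply: asboolP.
have gB : group_set B.
  apply/group_setP; split; first exact/BP/nsub1.
  by move=> x y /BP Nx /BP Ny; apply/BP/nsubM.
have nB : Group gB <| [subg A].
  rewrite /normal finset.subsetT /=; apply/fintype.subsetP=> y _; rewrite inE.
  apply/fintype.subsetP=> _ /imsetP[x /BP Nx ->]; apply/BP; exact: normal_conjP.
have [/= B1|/= BT] := simS _ nB; [left|right].
  apply/seteqP; split=> [x /BP|x ->] /=; last exact: nsub1.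
  by rewrite B1 inE => /eqP.
by apply/seteqP; split=> // x _; apply/BP; rewrite BT inE.
Qed.

Lemma finite_group_embeds_simple (Q : groupType) : finite_group Q ->
  exists2 S : groupType, finite_simple_group S & embeds Q S.
Proof.
move=> /finite_group_perm[T [h [T_gt0 h_inj]]].
(* One doubling makes the action even; three of them permute at least eight
   points, and alternating groups are simple from five points on. *)
pose Z : finType := (T * bool * bool * bool)%type.
pose k x : {perm Z} := double_perm (double_perm (double_perm (h x))).
have k_even x : k x \in 'Alt_Z by rewrite Alt_even odd_double_perm.
pose j x : subg_of 'Alt_Z := subg 'Alt_Z (k x).
have jM : {morph j : x y / x * y}.
  by move=> x y; rewrite /j -subgM // /k gmulfM !double_permM.
exists (subg_of 'Alt_Z).
  apply/finite_simple_subg/simple_Alt5.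
  by rewrite !card_prod card_bool; case: #|T| T_gt0 => // n _; rewrite !mulSn.
pose j' : {multiplicative Q -> subg_of 'Alt_Z} :=
  HB.pack j (isMultiplicative.Build _ _ j jM).
exists j'.
move=> x y /= /(congr1 val) /=; rewrite !subgK //.
by do 3!move/double_perm_inj; apply: h_inj.
Qed.

(** * Almost diagonal families *)

Section AlmostDiagonal.
Variables (I : eqType) (S : I -> groupType).

Definition dep_product := forall i, S i.

HB.instance Definition _ := gen_eqMixin dep_product.
HB.instance Definition _ := gen_choiceMixin dep_product.

Let prod_one : dep_product := fun=> 1.
Let prod_inv (x : dep_product) : dep_product := fun i => (x i)^-1.
Let prod_mul (x y : dep_product) : dep_product := fun i => x i * y i.

Let prod_mulA : associative prod_mul.
Proof. by move=> x y z; apply: functional_extensionality_dep => i; apply: mulgA. Qed.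
Let prod_mul1 : left_id prod_one prod_mul.
Proof. by move=> x; apply: functional_extensionality_dep => i; apply: mul1g. Qed.
Let prod_mulr1 : right_id prod_one prod_mul.
Proof. by move=> x; apply: functional_extensionality_dep => i; apply: mulg1. Qed.
Let prod_mulV : left_inverse prod_one prod_inv prod_mul.
Proof. by move=> x; apply: functional_extensionality_dep => i; apply: mulVg. Qed.
Let prod_mulrV : right_inverse prod_one prod_inv prod_mul.
Proof. by move=> x; apply: functional_extensionality_dep => i; apply: mulgV. Qed.

HB.instance Definition _ := isGroup.Build dep_product
  prod_mulA prod_mul1 prod_mulr1 prod_mulV prod_mulrV.

Variables (G : groupType) (phi : forall i, {multiplicative G -> S i}).

Definition almost_diagonal : pred dep_product :=
  fun x => `[< exists g, finite_set [set i | x i <> phi i g] >].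

Lemma almost_diagonal_closed : group_closed almost_diagonal.
Proof.
split=> [|x y /asboolP[g fing] /asboolP[h finh]]; apply/asboolP.
  exists 1; rewrite [X in finite_set X](_ : _ = set0) ?finite_set0 //.
  by apply/seteqP; split=> // i /=; rewrite multiplicative1.
exists (g * h^-1).
apply: (@sub_finite_set _ _ ([set i | x i <> phi i g] `|` [set i | y i <> phi i h])).
  move=> i /= xy; apply/not_andP => -[xg yh]; apply: xy.
  by rewrite gmulfM multiplicativeV -xg -yh.
by rewrite finite_setU.
Qed.

Definition almost_diagonal_group := {x : dep_product | almost_diagonal x}.

HB.instance Definition _ := SubChoice.on almost_diagonal_group.
HB.instance Definition _ :=
  SubChoice_isSubGroup.Build dep_product almost_diagonal almost_diagonal_group
    almost_diagonal_closed.

Local Notation Gamma := almost_diagonal_group.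

Definition coordinate i (x : Gamma) : S i := val x i.

Let coordinateM i : {morph @coordinate i : x y / x * y}.
Proof. by move=> x y; rewrite /coordinate valM. Qed.

HB.instance Definition _ i :=
  isMultiplicative.Build Gamma (S i) (@coordinate i) (coordinateM i).

Lemma eq_coordinate (x y : Gamma) :
  (forall i, coordinate i x = coordinate i y) -> x = y.
Proof. by move=> xy; apply/val_inj/functional_extensionality_dep. Qed.

(** Modifying the identity at a single coordinate stays within Gamma. *)
Lemma coordinate_onto i s : exists x, coordinate i x = s.
Proof.
pose x : dep_product := dfwith (fun j => 1 : S j) s.
have xP : almost_diagonal x.
  apply/asboolP; exists 1; apply: (sub_finite_set _ (finite_set1 i)) => j /= xj.
  apply: contrapT => ji; apply: xj.
  by rewrite /x dfwith_out ?multiplicative1 //; apply/eqP => /esym.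
by exists (Sub x xP); rewrite /coordinate SubK /x dfwith_in.
Qed.

(** Away from the finitely many exceptional coordinates the order of g kills x;
at each of those, the order of that one coordinate does. *)
Lemma torsion_almost_diagonal :
  torsion_group G -> (forall i, torsion_group (S i)) -> torsion_group Gamma.
Proof.
move=> torG torS x; have /asboolP[g finD] := valP x.
have [k k_gt0 gk] := torG g.
have /choice[o oP] i : exists n, 0 < n /\ coordinate i x ^+ n = 1.
  by have [n] := torS i (coordinate i x); exists n.
have /finite_seqP[r rE] := finite_image o finD.
(* The factorial is a common multiple of the exponents o i at the exceptional
   coordinates. *)
pose m := (\max_(n <- r) n)`!.
exists (k * m)%N; first by rewrite muln_gt0 k_gt0 fact_gt0.
apply: eq_coordinate => i; rewrite multiplicativeX multiplicative1 /=.
have [xi|xi] := EM (coordinate i x = phi i g).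
  by rewrite xi -multiplicativeX expgM gk expg1n multiplicative1.
have [oi_gt0 xoi] := oP i.
have oi_r : o i \in r.
  by have : (o @` [set i | val x i <> phi i g]) (o i) by [exists i]; rewrite rE.
have /dvdnP[q ->] : o i %| k * m.
  by apply/dvdn_mull/dvdn_fact; rewrite oi_gt0 leq_bigmax_seq.
by rewrite mulnC expgM xoi expg1n.
Qed.

Lemma residually_finite_simple_almost_diagonal :
  (forall i, finite_simple_group (S i)) ->
  residually finite_simple_group Gamma.
Proof.
move=> simS; apply/seteqP; split=> [x xK /=|_ -> N _]; last exact: nsub1.
apply: eq_coordinate => i; rewrite multiplicative1.
apply: (xK (kernel (@coordinate i))).
by apply: finite_simple_quot_kernel => //; apply: coordinate_onto.
Qed.

Lemma embeds_almost_diagonal :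
  (forall g, (forall i, phi i g = 1) -> g = 1) -> embeds G Gamma.
Proof.
move=> sep.
have diagP g : almost_diagonal (fun i => phi i g).
  apply/asboolP; exists g; rewrite [X in finite_set X](_ : _ = set0) ?finite_set0 //.
  by apply/seteqP; split.
pose diag g : Gamma := Sub (fun i => phi i g) (diagP g).
have diagE i g : coordinate i (diag g) = phi i g by rewrite /coordinate SubK.
have diagM : {morph diag : g h / g * h}.
  by move=> g h; apply: eq_coordinate => i; rewrite gmulfM !diagE gmulfM.
pose diag' : {multiplicative G -> Gamma} :=
  HB.pack diag (isMultiplicative.Build _ _ diag diagM).
exists diag' => g h /= gh.
apply/divg1_eq/sep => i.
by rewrite gmulfM multiplicativeV -!diagE gh mulgV.
Qed.

End AlmostDiagonal.

Theorem theorem1p2 (G : groupType) :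
  finitely_generated G -> residually finite_group G -> torsion_group G ->
  exists Gamma : groupType,
    [/\ torsion_group Gamma, residually finite_simple_group Gamma
      & embeds G Gamma].
Proof.
move=> _ resG torG.
(* [dfwith], which builds the preimages under the coordinate projections,
   compares indices, hence the classical equality on this type. *)
pose I : eqType :=
  {classic {N : normal_subgroup G | finite_group (quot_group N)}}.
have /choice[S SP] (i : I) : exists S : groupType, finite_simple_group S /\
    exists f : {multiplicative G -> S}, forall g, f g = 1 -> (sval i : set G) g.
  have [S simS [f f_inj]] := finite_group_embeds_simple (svalP i).
  exists S; split=> //; pose p g := f (\pi_(quot_group (sval i)) g).
  have pM : {morph p : g h / g * h} by move=> g h; rewrite /p piM gmulfM.
  pose p' : {multiplicative G -> S} :=
    HB.pack p (isMultiplicative.Build _ _ p pM).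
  exists p' => g /=.
  rewrite -(multiplicative1 f) => /f_inj/esym/eqP/quot_piP.
  by rewrite invg1 mul1g.
pose phi i := projT1 (cid (SP i).2).
have phiP i g : phi i g = 1 -> (sval i : set G) g := projT2 (cid (SP i).2) g.
exists (almost_diagonal_group phi); split.
- apply: torsion_almost_diagonal => // i.
  exact: finite_group_torsion (SP i).1.1.
- by apply: residually_finite_simple_almost_diagonal => i; have [] := SP i.
- apply: embeds_almost_diagonal => g g1.
  suff : [set (1 : G)] g by [].
  rewrite -resG => N finN; exact: (phiP (exist _ N finN)).
Qed.
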